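(* Let $A$ be a Weil algebra, let $I\subset A$ be an invariant ideal, and let $\phi\colon A\to B=A/I$ be the canonical projection. If $I\subseteq\mathrm{Ann}(I)\cap\mathfrak m_A^2$ and the affine sequence $K(I)\to\mathrm{Aut}(A)\xrightarrow{\phi_*}\mathrm{Aut}(B)$ associated to $I$ is exact, then $\phi_*\colon\mathrm{Aut}(A)\to\mathrm{Aut}(B)$ is endowed with a natural structure of affine bundle associated with the vector space $\mathrm{Der}(A,I)$, with addition law $$\sigma\oplus D=\sigma+\sigma\circ D,\qquad \sigma\in\mathrm{Aut}(A),\ D\in\mathrm{Der}(A,I).$$
   Context: A Weil algebra is a finite-dimensional local commutative $\mathbb R$-algebra with unit and residue field $\mathbb R$; $\mathfrak m_A$ is its maximal ideal; $\mathrm{Aut}(A)$ is its group of $\mathbb R$-algebra automorphisms (a linear algebraic group). $\mathrm{Ann}(I)=\{a\in A: ab=0\ \forall b\in I\}$. An ideal $I$ is invariant if $\sigma(I)=I$ for all $\sigma\in\mathrm{Aut}(A)$; then each $\sigma$ induces $\phi_*(\sigma)\in\mathrm{Aut}(B)$. $K(I)=\{\sigma\in\mathrm{Aut}(A):\sigma(a)-a\in I\ \forall a\in A,\ \sigma(b)=b\ \forall b\in I\}$. The affine sequence is exact on the left side if $K(I)=\ker\phi_*$, exact on the right side if $\phi_*$ is surjective, and exact if both hold. $\mathrm{Der}(A,I)$ is the space of $\mathbb R$-linear derivations from $A$ to the $A$-module $I$. The structure of affine bundle means that $(\sigma,D)\mapsto\sigma\oplus D$ maps $\mathrm{Aut}(A)\times\mathrm{Der}(A,I)$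 to $\mathrm{Aut}(A)$, preserves the fibres of $\phi_*$, and makes each fibre of $\phi_*$ an affine space modelled on the vector space $\mathrm{Der}(A,I)$. *)

(* Defs.v *)
From HB Require Import structures.
From mathcomp Require Import all_boot all_order all_algebra.
From mathcomp Require Import generic_quotient ring_quotient.
From mathcomp Require Import boolp classical_sets reals.

Set Implicit Arguments.
Unset Strict Implicit.
Unset Printing Implicit Defensive.

Import GRing.Theory.

Local Open Scope classical_set_scope.
Local Open Scope ring_scope.
Local Open Scope quotient_scope.

(* Ideals are elements of MathComp's [idealr A], hence proper (1 \notin I);
   this loses nothing for ideals contained in a maximal one. *)

Section QuotientAlgebra.
Variables (K : comNzRingType) (A : comAlgType K) (I : idealr A).
Local Notation B := {ideal_quot I}.

Lemma pi_eqE (a b : A) : (\pi_B a == \pi_B b) = (a - b \in I).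
Proof. by rewrite piE Quotient.equivE. Qed.

Definition quot_scale (k : K) : B -> B := lift_op1 B (fun a : A => k *: a).

Lemma pi_scale k (a : A) : quot_scale k (\pi_B a) = \pi_B (k *: a).
Proof.
unlock quot_scale; apply/eqP; rewrite pi_eqE -scalerBr -[X in k *: X]mul1r.
by rewrite scalerAl; apply: idealMr; rewrite -pi_eqE reprK.
Qed.

Fact quot_scaleA k l (b : B) :
  quot_scale k (quot_scale l b) = quot_scale (k * l) b.
Proof. by elim/quotW: b => a; rewrite !pi_scale scalerA. Qed.

Fact quot_scale1 : left_id 1 quot_scale.
Proof. by elim/quotW=> a; rewrite pi_scale scale1r. Qed.

Fact quot_scaleDr : right_distributive quot_scale +%R.
Proof.
move=> k; elim/quotW=> a; elim/quotW=> b.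
by rewrite -rmorphD !pi_scale -rmorphD scalerDr.
Qed.

Fact quot_scaleDl (b : B) : {morph quot_scale^~ b : k l / k + l}.
Proof.
by move=> k l; elim/quotW: b => a; rewrite !pi_scale -rmorphD scalerDl.
Qed.

HB.instance Definition _ := GRing.Zmodule_isLmodule.Build K B
  quot_scaleA quot_scale1 quot_scaleDr quot_scaleDl.

Fact quot_scaleAl k (b c : B) : k *: (b * c) = (k *: b) * c.
Proof.
elim/quotW: b => b; elim/quotW: c => c.
change (quot_scale k (\pi_B b * \pi_B c) = quot_scale k (\pi_B b) * \pi_B c).
by rewrite -rmorphM !pi_scale -rmorphM scalerAl.
Qed.

HB.instance Definition _ := GRing.Lmodule_isLalgebra.Build K B quot_scaleAl.

Fact quot_scaleAr k (b c : B) : k *: (b * c) = b * (k *: c).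
Proof. by rewrite mulrC scalerAl mulrC. Qed.

HB.instance Definition _ := GRing.Lalgebra_isAlgebra.Build K B quot_scaleAr.

Fact pi_is_scalable : scalable (\pi_B : A -> B).
Proof. by move=> k a; rewrite -pi_scale. Qed.

HB.instance Definition _ := GRing.isScalable.Build K A B *:%R (\pi_B : A -> B)
  pi_is_scalable.

End QuotientAlgebra.

Definition maximal_ideal (A : comNzRingType) (M : idealr A) : Prop :=
  forall J : idealr A, {subset M <= J} -> J =i M.

(* Being local is the uniqueness of the maximal ideal; "residue field R" means
   that the structure map R -> A / m is bijective. *)
HB.mixin Record isWeil (R : realType) A
    of GRing.ComAlgebra R A & Vector R A := {
  maxid : idealr A;
  maxid_maximal : maximal_ideal maxid;
  maxid_unique : forall M : idealr A, maximal_ideal M -> M =i maxid;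
  maxid_residue : bijective (fun r : R => r%:A : {ideal_quot maxid})
}.

#[short(type="weilAlgType")]
HB.structure Definition WeilAlgebra (R : realType) :=
  {A of isWeil R A & GRing.ComAlgebra R A & Vector R A}.

Arguments maxid {R} s.

Section Automorphisms.
Variables (K : comNzRingType) (A : algType K).

Record algAut := MkAlgAut {
  aut_val :> A -> A;
  aut_linear : linear aut_val;
  aut_monoid : monoid_morphism aut_val;
  aut_bij : bijective aut_val
}.

HB.instance Definition _ (s : algAut) :=
  GRing.isLinear.Build K A A *:%R s (aut_linear s).
HB.instance Definition _ (s : algAut) :=
  GRing.isMonoidMorphism.Build A A s (aut_monoid s).

Lemma autP (s t : algAut) : s =1 t -> s = t.
Proof.
case: s t => [f lf mf bf] [g lg mg bg] /= /funext efg.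
by case: _ / efg in lg mg bg *; congr MkAlgAut; apply: Prop_irrelevance.
Qed.

Definition aut_one : algAut :=
  @MkAlgAut idfun (fun _ _ _ => erefl) (conj erefl (fun _ _ => erefl))
    (Bijective (fun=> erefl) (fun=> erefl)).

Fact aut_mul_linear (s t : algAut) : linear (s \o t).
Proof. by move=> k a b /=; rewrite !linearP. Qed.
Fact aut_mul_monoid (s t : algAut) : monoid_morphism (s \o t).
Proof. by split=> [|a b] /=; rewrite ?rmorph1 ?rmorphM. Qed.

Definition aut_mul (s t : algAut) : algAut :=
  MkAlgAut (aut_mul_linear s t) (aut_mul_monoid s t)
    (bij_comp (aut_bij s) (aut_bij t)).

Fact aut_inv_subproof (s : algAut) : {t : algAut | cancel t s & cancel s t}.
Proof.
have /cid2 [g sK gK] : exists2 g, cancel s g & cancel g s.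
  by case: (aut_bij s) => g; exists g.
have lg : linear g by move=> k a b; apply: (canLR sK); rewrite linearP/= !gK.
have mg : monoid_morphism g.
  by split=> [|a b]; apply: (canLR sK); rewrite ?rmorph1 ?rmorphM/= ?gK.
by exists (MkAlgAut lg mg (Bijective gK sK)).
Qed.

Definition aut_inv (s : algAut) : algAut := s2val (aut_inv_subproof s).

Lemma aut_invK (s : algAut) : cancel (aut_inv s) s.
Proof. by rewrite /aut_inv; case: aut_inv_subproof. Qed.
Lemma autK (s : algAut) : cancel s (aut_inv s).
Proof. by rewrite /aut_inv; case: aut_inv_subproof. Qed.

HB.instance Definition _ := gen_eqMixin algAut.
HB.instance Definition _ := gen_choiceMixin algAut.

Fact aut_mulA : associative aut_mul. Proof. by move=> *; apply: autP. Qed.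
Fact aut_mul1 : left_id aut_one aut_mul. Proof. by move=> *; apply: autP. Qed.
Fact aut_mulr1 : right_id aut_one aut_mul.
Proof. by move=> *; apply: autP. Qed.
Fact aut_mulV : left_inverse aut_one aut_inv aut_mul.
Proof. by move=> s; apply: autP; apply: autK. Qed.
Fact aut_mulrV : right_inverse aut_one aut_inv aut_mul.
Proof. by move=> s; apply: autP; apply: aut_invK. Qed.

HB.instance Definition _ :=
  isGroup.Build algAut aut_mulA aut_mul1 aut_mulr1 aut_mulV aut_mulrV.

End Automorphisms.

Section AffineSequence.
Variables (K : comNzRingType) (A : comAlgType K) (I : idealr A).
Local Notation B := {ideal_quot I}.

Definition invariant_ideal : Prop :=
  forall s : algAut A, s @` [set` I] = [set` I].

Hypothesis Iinv : invariant_ideal.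

Definition induced_fun (s : algAut A) : B -> B := lift_op1 B s.

Fact pi_induced (s : algAut A) (a : A) :
  induced_fun s (\pi_B a) = \pi_B (s a).
Proof.
have : [set` I] (s (repr (\pi_B a) - a)).
  by rewrite -(Iinv s); apply: imageP; rewrite /= -pi_eqE reprK.
by unlock induced_fun; rewrite rmorphB => sI; apply/eqP; rewrite pi_eqE.
Qed.

Fact induced_linear s : linear (induced_fun s).
Proof.
move=> k; elim/quotW=> a; elim/quotW=> b.
by rewrite -linearP !pi_induced linearP linearP.
Qed.

Fact induced_monoid s : monoid_morphism (induced_fun s).
Proof.
split=> [|b c]; first by rewrite -(rmorph1 \pi_B) pi_induced !rmorph1.
elim/quotW: b => a; elim/quotW: c => b.
by rewrite -rmorphM !pi_induced -!rmorphM.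
Qed.

Fact induced_bij s : bijective (induced_fun s).
Proof.
by exists (induced_fun (s^-1)%g); elim/quotW => a;
  rewrite !pi_induced ?autK ?aut_invK.
Qed.

(* phi_*(s), the automorphism b = pi a |-> pi (s a); see [pi_induced]. *)
Definition induced (s : algAut A) : algAut B :=
  MkAlgAut (induced_linear s) (induced_monoid s) (induced_bij s).

Definition affine_kernel : set (algAut A) :=
  [set s | (forall a, s a - a \in I) /\ (forall b, b \in I -> s b = b)].

Definition exact_left : Prop := affine_kernel = [set s | induced s = 1%g].

Definition exact_right : Prop := forall t : algAut B, exists s, induced s = t.

Definition affine_exact : Prop := exact_left /\ exact_right.

End AffineSequence.

Definition annihilator (A : comNzRingType) (S : set A) : set A :=
  [set a | forall b, S b -> a * b = 0].

Definition ideal_mul (A : comNzRingType) (S T : set A) : set A :=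
  [set a | exists n (x y : 'I_n -> A),
     [/\ forall i, S (x i), forall i, T (y i) & a = \sum_i x i * y i]].

Section Derivations.
Variables (R : realType) (A : weilAlgType R) (I : idealr A).

Definition is_der : {pred 'End(A)} := fun D : 'End(A) =>
  `[< (forall a, D a \in I) /\
      (forall a b, D (a * b) = a * D b + b * D a) >].

Fact is_der_submod : submod_closed is_der.
Proof.
split=> [|k D E /asboolP[DI Dd] /asboolP[EI Ed]]; apply/asboolP; split=> a.
- by rewrite lfunE idealr0.
- by move=> b; rewrite !lfunE /= !mulr0 addr0.
- rewrite !lfunE /= lfunE /= rpredD ?EI//.
  by rewrite -[D a]mul1r scalerAl idealMr ?DI.
- move=> b; rewrite !lfunE /= !lfunE /= Dd Ed !mulrDr scalerDr -!scalerAr.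
  by rewrite addrACA.
Qed.

HB.instance Definition _ := GRing.isSubmodClosed.Build R 'End(A) is_der
  is_der_submod.

(* Der(A, I): the R-linear derivations A -> I, composed with I \subset A. *)
Record Der := MkDer { der_val :> 'End(A); _ : der_val \in is_der }.

HB.instance Definition _ := [isSub for der_val].
HB.instance Definition _ := [Choice of Der by <:].
HB.instance Definition _ := [SubChoice_isSubLmodule of Der by <:].

End Derivations.

Definition affine_space (K : nzRingType) (V : lmodType K) (T : Type)
    (F : set T) (act : T -> V -> T) : Prop :=
  [/\ F !=set0,
      forall x v, F x -> F (act x v),
      forall x, F x -> act x 0 = x,
      forall x u v, F x -> act (act x u) v = act x (u + v) &
      forall x y, F x -> F y -> exists! v, act x v = y].

Definition affine_bundle (K : nzRingType) (V : lmodType K) (E M : Type)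
    (p : E -> M) (act : E -> V -> E) : Prop :=
  forall b : M, affine_space (p @^-1` [set b]) act.

(* Main.v *)
From HB Require Import structures.
Require Import Defs.
From mathcomp Require Import all_boot all_order all_algebra.
From mathcomp Require Import generic_quotient ring_quotient.
From mathcomp Require Import boolp classical_sets reals.

Set Implicit Arguments.
Unset Strict Implicit.
Unset Printing Implicit Defensive.

Import GRing.Theory.
Local Open Scope classical_set_scope.
Local Open Scope ring_scope.
Local Open Scope quotient_scope.

(** Since [s + s \o D = s \o (1 + D)], everything rests on the map [1 + D] of a
    derivation [D : A -> I].  It is multiplicative because the error term
    [D a * D b] lies in [I * I], which vanishes as [I] annihilates itself.

    The point that needs an argument is that [1 + D] is bijective.  On [I] the
    derivation [D] is [A]-linear, again because [I * I = 0], and [I <= m^2]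
    together with the Leibniz rule gives [D I <= m I].  So [I] is contained in
    [(1 + D) I + m I], hence in [(1 + D) I] by Nakayama's lemma
    ([nakayama], [der_step_bij]).  As [a = (1 + D) a - D a], the map [1 + D]
    is onto [A], and finite dimension makes it bijective.  Nakayama's lemma
    needs [1 - x] to be invertible for [x] in [m] ([maxid_unit1B]); a non-unit
    would generate a proper ideal, contained in a maximal one by a dimension
    argument, and [m] is the only maximal ideal.

    Now [1 + D] induces the identity on [A / I], so exactness on the left puts
    it in [K(I)]: it fixes [I], that is, [D] kills [I].  Hence [D \o E = 0] for
    all [D, E], and [(1 + D) \o (1 + E) = 1 + (D + E)], which makes the addition
    an action of the vector space of derivations.  It moves points within
    fibres since [s (D a)] is in [I].  Conversely, if [s] and [s'] induce the
    same automorphism, then [s^-1 s' - 1] takes values in [I], and it is a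
    derivation ([aut_sub_der]) because [I * I = 0]; it is the only [D] that
    carries [s] to [s'].  Exactness on the right says that fibres are
    nonempty. *)

(** * Ideals of a finite-dimensional local algebra *)

(** A subspace of largest dimension inside [P] is all of [P], since any further
    vector of [P] would enlarge it.  This gives access to bases of ideals. *)
Lemma zmod_vspace (K : fieldType) (V : vectType K) (P : zmodClosed V) :
  (forall k v, v \in P -> k *: v \in P) -> exists U : {vspace V}, U =i P.
Proof.
move=> PZ.
pose dims (n : nat) :=
  `[< exists2 U : {vspace V}, {subset U <= P} & \dim U = n >].
have dims0 : exists n, dims n.
  exists 0%N; apply/asboolP; exists 0%VS; last exact: dimv0.
  by move=> v; rewrite memv0 => /eqP->; apply: rpred0.
have dims_le n : dims n -> (n <= \dim {:V})%N.
  by move=> /asboolP[U _ <-]; apply: dimvS; apply: subvf.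
case: (ex_maxnP dims0 dims_le) => n /asboolP[U UP dimU] maxn.
exists U => v; apply/idP/idP=> [|vP]; first exact: UP.
have dimUv : (\dim (U + <[v]>) <= \dim U)%N.
  rewrite dimU; apply: maxn; apply/asboolP; exists (U + <[v]>)%VS => //.
  move=> _ /memv_addP[u uU [_ /vlineP[k ->] ->]].
  by apply: rpredD; [apply: UP | apply: PZ].
move: dimUv; rewrite (geq_leqif (dimv_leqif_sup (addvSl U <[v]>))).
by rewrite subv_add => /andP[_]; rewrite -memvE.
Qed.

Lemma idealZ (K : comNzRingType) (A : comAlgType K) (I : idealr A) (k : K) a :
  a \in I -> k *: a \in I.
Proof. by rewrite -[a in k *: a]mul1r scalerAl; apply: idealMr. Qed.

Section WeilIdeals.
Variables (R : realType) (A : weilAlgType R).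

Lemma idealr_vspace (I : idealr A) : exists U : {vspace A}, U =i I.
Proof. by apply: zmod_vspace => k v; apply: idealZ. Qed.

(** Finite dimension replaces Zorn's lemma: a proper ideal of largest dimension
    above [I] is maximal. *)
Lemma sub_maximal_ideal (I : idealr A) :
  exists2 M : idealr A, maximal_ideal M & {subset I <= M}.
Proof.
pose dims (n : nat) := `[< exists (J : idealr A) (U : {vspace A}),
  [/\ {subset I <= J}, U =i J & \dim U = n] >].
have dimsI : exists n, dims n.
  have [U UI] := idealr_vspace I.
  by exists (\dim U); apply/asboolP; exists I, U; split.
have dims_le n : dims n -> (n <= \dim {:A})%N.
  by move=> /asboolP[J [U [_ _ <-]]]; apply: dimvS; apply: subvf.
case: (ex_maxnP dimsI dims_le) => n /asboolP[M [U [IM UM dimU]]] maxn.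
exists M => // J MJ x; have [W WJ] := idealr_vspace J.
have UW : (U <= W)%VS by apply/subvP=> y; rewrite UM WJ; apply: MJ.
have dimW : (\dim W <= \dim U)%N.
  rewrite dimU; apply: maxn; apply/asboolP; exists J, W.
  by split=> // y yI; apply/MJ/IM.
have WU : (W <= U)%VS by rewrite -(geq_leqif (dimv_leqif_sup UW)).
by rewrite -UM -WJ; apply/idP/idP; apply: subvP.
Qed.

(** Otherwise the multiples of [1 - x] form a proper ideal.  It lies in some
    maximal ideal, which can only be [maxid A]; the latter then contains
    [1 - x] and [x], hence [1]. *)
Lemma maxid_unit1B (x : A) : x \in maxid A -> exists u, u * (1 - x) = 1.
Proof.
move=> xm; apply: contrapT => nunit.
pose P : {pred A} := fun a => `[< exists u : A, a = u * (1 - x) >].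
have Pideal : idealr_closed P.
  split=> [||a _ _ /asboolP[v ->] /asboolP[w ->]].
  - by apply/asboolP; exists 0; rewrite mul0r.
  - by apply/asboolP => -[u u1]; apply: nunit; exists u.
  - by apply/asboolP; exists (a * v + w); rewrite mulrDl mulrA.
pose HP := isIdealr.Build A P Pideal.
pose J : idealr A := HB.pack P HP.
have [M Mmax JM] := sub_maximal_ideal J.
have : 1 - x \in maxid A.
  rewrite -(maxid_unique M Mmax); apply: JM.
  by apply/asboolP; exists 1; rewrite mul1r.
move=> /rpredD /(_ xm); rewrite subrK.
by rewrite idealr1.
Qed.

End WeilIdeals.

(** Nakayama's lemma, with the finitely generated module given by its
    generators [e]: if each [e i] is modulo [N] a combination of the [e j] with
    coefficients in [J], then every [e i] is in [N].  The proof is Gaussian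
    elimination: the relation for [e 0] expresses it through the others because
    [1 - c 0 0] is invertible, and substituting it into the other relations
    keeps their coefficients in [J]. *)
Lemma nakayama (A : comNzRingType) (J : idealr A) (N : zmodClosed A) n
    (e : 'I_n -> A) (c : 'I_n -> 'I_n -> A) :
    (forall x, x \in J -> exists u, u * (1 - x) = 1) ->
    (forall x a, a \in N -> x * a \in N) ->
    (forall i j, c i j \in J) ->
    (forall i, e i - \sum_j c i j * e j \in N) ->
  forall i, e i \in N.
Proof.
move=> Junit NM; elim: n e c => [|n IHn] e c cJ eN; first by case.
have [u u1] := Junit _ (cJ ord0 ord0).
pose f j := e (lift ord0 j).
have e0N : e ord0 - u * (\sum_j c ord0 (lift ord0 j) * f j) \in N.
  have := NM u _ (eN ord0); rewrite big_ord_recl opprD addrA.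
  by rewrite -[X in X - _ * _]mul1r -mulrBl mulrBr mulrA u1 mul1r.
have fN : forall j, f j \in N.
  pose c' i j := c (lift ord0 i) (lift ord0 j)
    + c (lift ord0 i) ord0 * (u * c ord0 (lift ord0 j)).
  apply: (IHn f c') => [i j | i].
    by rewrite rpredD ?cJ // mulrA idealMr ?cJ.
  have := rpredD (eN (lift ord0 i)) (NM (c (lift ord0 i) ord0) _ e0N).
  congr (_ \in N); rewrite big_ord_recl /c'.
  under [in RHS]eq_bigr do rewrite mulrDl -!mulrA.
  rewrite big_split /= -!mulr_sumr mulrBr -/(f i).
  set a := _ * e ord0; set s := \sum_j _; set b := \sum_j _.
  by rewrite -addrA [a + s]addrC opprD -addrA addKr -opprD.
move=> i; case: (unliftP ord0 i) => [j ->|->]; first exact: fN.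
rewrite -[e ord0](subrK (u * (\sum_j c ord0 (lift ord0 j) * f j))).
by rewrite rpredD // NM // rpred_sum // => j _; rewrite NM.
Qed.

(** * Automorphisms and the quotient *)

Section InducedAutomorphisms.
Variables (K : comNzRingType) (A : comAlgType K) (I : idealr A).

Hypothesis Iinv : invariant_ideal I.

Lemma aut_ideal (s : algAut A) a : a \in I -> s a \in I.
Proof.
by move=> aI; have : [set` I] (s a) by rewrite -(Iinv s); apply: imageP.
Qed.

Lemma induced_eqP (s t : algAut A) :
  induced Iinv s = induced Iinv t <-> forall a, s a - t a \in I.
Proof.
split=> [st a|st].
  have /= := congr1 (fun u : algAut _ => u (\pi_({ideal_quot I}) a)) st.
  by rewrite !(pi_induced Iinv) => e; rewrite -pi_eqE e.
apply: autP => /=; elim/quotW => a; rewrite !(pi_induced Iinv).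
by apply/eqP; rewrite pi_eqE.
Qed.

Lemma induced1 : induced Iinv 1%g = 1%g.
Proof. by apply: autP => /=; elim/quotW => a; rewrite (pi_induced Iinv). Qed.

(** Exactness on the left enters here: being the identity modulo [I] already
    forces being the identity on [I]. *)
Lemma exact_left_fix (s : algAut A) : exact_left Iinv ->
  (forall a, s a - a \in I) -> forall b, b \in I -> s b = b.
Proof.
move=> kerE s1; have : affine_kernel I s; last by case.
by rewrite kerE /= -induced1; apply/induced_eqP.
Qed.

End InducedAutomorphisms.

(** * Derivations into a square-zero ideal inside the square of m *)

Section Derivations.
Variables (R : realType) (A : weilAlgType R) (I : idealr A).

Lemma der_in (D : Der I) a : D a \in I.
Proof. by case: D => D /= /asboolP[]. Qed.

Lemma derM (D : Der I) a b : D (a * b) = a * D b + b * D a.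
Proof. by case: D => D /= /asboolP[_]. Qed.

Lemma der1 (D : Der I) : D 1 = 0.
Proof.
by apply: (addIr (D 1)); rewrite add0r -[in RHS](mulr1 1) derM !mul1r.
Qed.

Hypothesis I2_0 : [set` I] `<=` annihilator [set` I].
Hypothesis I_m2 : [set` I] `<=` ideal_mul [set` maxid A] [set` maxid A].

Lemma ideal_mul0 a b : a \in I -> b \in I -> a * b = 0.
Proof. by move=> /I2_0; apply. Qed.

(** Expanding [(a + D a) * (b + D b) = a * b + D (a * b)] leaves the Leibniz rule
    once the product [D a * D b] vanishes. *)
Lemma aut_sub_der (s : algAut A) : (forall a, s a - a \in I) ->
  exists D : Der I, forall a, s a = a + D a.
Proof.
move=> s1; pose D : 'End(A) := linfun s - \1%VF.
have DE a : D a = s a - a by rewrite add_lfunE opp_lfunE id_lfunE lfunE.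
have sE a : s a = a + D a by rewrite DE addrC subrK.
have Dder : D \in is_der I.
  apply/asboolP; split=> a; first by rewrite DE.
  move=> b; have := sE (a * b); rewrite rmorphM /= (sE a) (sE b) mulrDl !mulrDr.
  have -> : D a * D b = 0 by rewrite ideal_mul0 // DE.
  by rewrite addr0 -addrA => /addrI <-; rewrite [D a * b]mulrC.
by exists (MkDer Dder).
Qed.

Definition der_step (D : Der I) : 'End(A) := (\1 + der_val D)%VF.

Lemma der_stepE D a : der_step D a = a + D a.
Proof. by rewrite add_lfunE id_lfunE. Qed.

Lemma der_step_monoid D : monoid_morphism (der_step D).
Proof.
split=> [|a b]; rewrite !der_stepE; first by rewrite der1 addr0.
by rewrite derM mulrDl !mulrDr (ideal_mul0 (der_in D a) (der_in D b)) addr0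
  -addrA [D a * b]mulrC.
Qed.

(** On [I], derivations are [A]-linear; so [(1 + D) I] is an ideal. *)
Lemma der_idealM (D : Der I) x a : a \in I -> D (x * a) = x * D a.
Proof.
by move=> aI; rewrite derM (ideal_mul0 aI (der_in D x)) addr0.
Qed.

(** The inclusion [D I <= m I], in coordinates: [D (x * y) = x * D y + y * D x]
    with [x, y] in [m] and with [D x, D y] in [I], hence combinations of the
    basis of [I] with scalar coefficients. *)
Lemma der_ideal_coord (U : {vspace A}) (D : Der I) a : U =i I -> a \in I ->
  exists2 c : 'I_(\dim U) -> A, (forall j, c j \in maxid A)
    & D a = \sum_j c j * (vbasis U)`_j.
Proof.
move=> UI /I_m2[n [x [y [xm ym ->]]]].
pose k b j := coord (vbasis U) j (D b).
exists (fun j => \sum_i (k (y i) j *: x i + k (x i) j *: y i)) => [j|].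
  by apply: rpred_sum => i _; rewrite rpredD ?idealZ ?xm ?ym.
have DE b : D b = \sum_j k b j *: (vbasis U)`_j.
  by apply: coord_vbasis; rewrite UI der_in.
rewrite linear_sum /=.
under [in RHS]eq_bigr do rewrite mulr_suml.
rewrite exchange_big; apply: eq_bigr => i _ /=.
rewrite derM (DE (y i)) (DE (x i)) !mulr_sumr -big_split; apply: eq_bigr => j _.
by rewrite mulrDl -!scalerAl -!scalerAr.
Qed.

(** Nakayama's lemma applies to a basis [e] of [I] and [N = (1 + D) I], because
    [e i + D (e i)] is in [N] and [D (e i)] is in [m I].  It gives [I <= N]; thus
    [1 + D] is onto, and injective by comparing dimensions. *)
Lemma der_step_bij D : bijective (der_step D).
Proof.
have [U UI] := idealr_vspace I.
have U_sub : (U <= der_step D @: U)%VS.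
  have coordD (i : 'I_(\dim U)) : exists c : 'I_(\dim U) -> A,
      (forall j, c j \in maxid A)
      /\ D (vbasis U)`_i = \sum_j c j * (vbasis U)`_j.
    have [|c cm cE] := @der_ideal_coord U D (vbasis U)`_i UI; last by exists c.
    by rewrite -UI vbasis_mem // mem_nth // size_tuple.
  have [c /all_and2[cm cE]] := boolp.choice coordD.
  have eU : forall i : 'I_(\dim U), (vbasis U)`_i \in (der_step D @: U)%VS.
    apply: (@nakayama _ (maxid A) (der_step D @: U)%VS _ _ (fun i j => - c i j)).
    - exact: maxid_unit1B.
    - move=> x _ /memv_imgP[a aU ->]; apply/memv_imgP; exists (x * a).
        by move: aU; rewrite !UI; apply: idealMr.
      by rewrite !der_stepE mulrDr der_idealM // -UI.
    - by move=> i j; rewrite rpredN cm.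
    - move=> i; under eq_bigr do rewrite mulNr.
      rewrite sumrN opprK -cE -der_stepE memv_img //.
      by rewrite vbasis_mem // mem_nth // size_tuple.
  apply/subvP => a /coord_vbasis ->.
  by apply: rpred_sum => i _; rewrite rpredZ ?eU.
have limgT : limg (der_step D) = fullv.
  apply/eqP; rewrite eqEsubv subvf; apply/subvP => a _.
  rewrite -[a](addrK (D a)) -der_stepE rpredB ?memv_img ?memvf //.
  apply: (subvP (limgS _ (subvf U))); apply: (subvP U_sub).
  by rewrite UI der_in.
have ker0 : lker (der_step D) == 0%VS.
  rewrite -dimv_eq0 -(eqn_add2r (\dim (limg (der_step D)))) add0n.
  by rewrite -[lker _]capfv limg_ker_dim limgT.
exists (der_step D)^-1%VF; first exact: lker0_lfunK.
exact: lker0_lfunVK.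
Qed.

Definition der_aut (D : Der I) : algAut A :=
  MkAlgAut (linearP (der_step D)) (der_step_monoid D) (der_step_bij D).

Lemma der_autE D a : der_aut D a = a + D a.
Proof. exact: der_stepE. Qed.

End Derivations.

Theorem theorem8 (R : realType) (A : weilAlgType R) (I : idealr A)
    (Iinv : invariant_ideal I)
    (Isub : [set` I] `<=`
       annihilator [set` I] `&` ideal_mul [set` maxid A] [set` maxid A])
    (Iexact : affine_exact Iinv) :
  exists oplus : algAut A -> Der I -> algAut A,
    (forall (s : algAut A) (D : Der I) (a : A), oplus s D a = s a + s (D a)) /\
    affine_bundle (induced Iinv) oplus.
Proof.
have [I2_0 I_m2] : [set` I] `<=` annihilator [set` I] /\
    [set` I] `<=` ideal_mul [set` maxid A] [set` maxid A].
  by split=> a /Isub[].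
have [kerE surj] := Iexact.
pose act s D := aut_mul s (der_aut I2_0 I_m2 D).
have actE s D a : act s D a = s a + s (D a).
  by rewrite -linearD -(der_autE I2_0 I_m2).
(* [1 + D] is trivial modulo [I], so by exactness it fixes [I]. *)
have der_I0 (D : Der I) b : b \in I -> D b = 0.
  move=> bI; apply: (addrI b); rewrite -(der_autE I2_0 I_m2) addr0.
  apply: (exact_left_fix kerE) => // a.
  by rewrite der_autE addrAC subrr add0r der_in.
exists act; split=> // t; split.
- by have [s st] := surj t; exists s.
- move=> s D <-; apply/induced_eqP => a.
  by rewrite actE addrAC subrr add0r aut_ideal ?der_in.
- by move=> s _; apply: autP => a; rewrite actE lfunE linear0 addr0.
- move=> s D E _; apply: autP => a.
  rewrite !actE (der_I0 D (E a)) ?der_in // linear0 addr0.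
  by rewrite -addrA -linearD lfunE.
- move=> s s' /= <- /esym/induced_eqP ss'.
  (* The derivation from [s] to [s'] is [s^-1 s' - 1], as [s'] is [s (1 + D)]. *)
  have [a|D DE] := @aut_sub_der _ _ _ I2_0 (aut_mul (aut_inv s) s').
    rewrite /= -[X in _ - X](autK s) -linearB aut_ideal //.
    by rewrite -opprB rpredN ss'.
  exists D; split=> [|E sE]; first apply: autP => a.
    by rewrite actE -linearD -DE /= aut_invK.
  apply/val_inj/lfunP => a; apply: (addrI a); rewrite -DE /= -sE actE.
  by rewrite -linearD autK.
Qed.
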